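(* For all positive integers $n$ and $m$, $$\Phi(n\times m,3,2,1)\le\begin{cases} \lfloor n(nm+2\Psi^e(m,3,2,1))/6\rfloor, & \text{if } m\equiv 0\pmod 2,\\ \lfloor n(nm+2\Psi^e(m,3,2,1)-1)/6\rfloor, & \text{if } m\equiv 1\pmod 2. \end{cases}$$
   Context: Let $I_n=\{0,1,\ldots,n-1\}$ and let $Z_m$ be the additive group of integers modulo $m$. For $B\subseteq I_n\times Z_m$ and an integer $s$, put $B+s=\{(i,x+s \bmod m):(i,x)\in B\}$. A $2$-D $(n\times m,3,2,1)$-OOC is a (possibly empty) set $\mathcal{B}$ of $3$-subsets of $I_n\times Z_m$ (codewords) such that: (1) $|B\cap(B+s)|\le 2$ for every $B\in\mathcal{B}$ and every integer $s\not\equiv 0\pmod m$; (2) $|A\cap(B+s)|\le 1$ for all $A,B\in\mathcal{B}$ with $A\ne B$ and every integer $s$. $\Phi(n\times m,3,2,1)$ denotes the largest number of codewords among all such codes. When $n=1$ such a code is called a $1$-D $(m,3,2,1)$-OOC and its codewords are regarded as $3$-subsets of $Z_m$. A $1$-D $(m,3,2,1)$-OOC is equi-difference if each of its codewords is of the form $\{0,a,2a\}$ with $a\in Z_m$; $\Psi^e(m,3,2,1)$ denotes the largest number of codewords among all equi-difference $1$-D $(m,3,2,1)$-OOCs. *)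

(* Defs.v *)
From mathcomp Require Import all_boot all_order all_algebra.
From mathcomp Require Import boolp.
Set Implicit Arguments.
Unset Strict Implicit.
Unset Printing Implicit Defensive.
Import GRing.Theory.
Local Open Scope ring_scope.

(* For 0 < m, m.-1.+1 is m, and 'I_m.-1.+1 carries the library's additive
   group structure of integers modulo m, including for m = 1, where 'Z_m would
   be the integers modulo 2. *)
Notation Zm m := 'I_m.-1.+1.

(* Zp1 *~ s is the residue class of the integer s. *)
Definition shift (n m : nat) (B : {set 'I_n * Zm m}) (s : int) :
    {set 'I_n * Zm m} :=
  [set (p.1, p.2 + Zp1 *~ s) | p in B].

Record is_ooc (n m : nat) (C : {set {set 'I_n * Zm m}}) : Prop := IsOoc {
  ooc_weight : forall B, B \in C -> #|B| = 3%N;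
  ooc_auto : forall B (s : int), B \in C -> ~~ (m%:Z %| s)%Z ->
    (#|B :&: shift B s| <= 2)%N;
  ooc_cross : forall A B (s : int), A \in C -> B \in C -> A != B ->
    (#|A :&: shift B s| <= 1)%N
}.

Definition Phi (n m : nat) : nat :=
  \max_(C : {set {set 'I_n * Zm m}} | `[< is_ooc C >]) #|C|.

(* A subset X of Z_m, regarded as a subset of I_1 x Z_m. *)
Definition row1 (m : nat) (X : {set Zm m}) : {set 'I_1 * Zm m} :=
  [set (ord0, x) | x in X].

Definition equi_difference (m : nat) (C : {set {set 'I_1 * Zm m}}) : Prop :=
  forall B, B \in C -> exists a : Zm m, B = row1 [set 0; a; a *+ 2].

(* Codewords still have weight 3, so a with {0, a, 2a} degenerate is excluded. *)
Definition Psi_e (m : nat) : nat :=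
  \max_(C : {set {set 'I_1 * Zm m}} | `[< is_ooc C /\ equi_difference C >])
    #|C|.

(* Main.v *)
(* Record each ordered pair of distinct points (i, x), (j, y) of a codeword by
   its difference (i, j, y - x).  The correlation conditions make the difference
   sets of distinct codewords disjoint.  A codeword has six differences unless
   two of them coincide, which happens only for a difference (i, i, h) with
   2 h = 0 or when the codeword is a translate of {0, a, 2a} in a single row; in
   the latter case at most two further differences are lost.  For each i there
   is at most one difference of the first kind, and none if m is odd, while the
   codewords of the second kind in row i translate to an equi-difference code. *)
Require Import Defs.
From mathcomp Require Import all_boot all_order all_algebra.
From mathcomp Require Import boolp zify.

Set Implicit Arguments.
Unset Strict Implicit.
Unset Printing Implicit Defensive.
Import GRing.Theory.

(** * Double counting over disjoint sets, and membership in a shift *)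

Lemma sum_card_setI_le (I T : finType) (C : {set I}) (F : I -> {set T})
    (X : {set T}) :
  {in C &, forall A B x, x \in F A -> x \in F B -> A = B} ->
  \sum_(B in C) #|F B :&: X| <= #|X|.
Proof.
move=> Finj.
have -> : \sum_(B in C) #|F B :&: X| = \sum_(B in C) \sum_(x in X) (x \in F B).
  apply: eq_bigr => B _; rewrite -sum1_card big_mkcond [RHS]big_mkcond /=.
  by apply: eq_bigr => x _; rewrite inE; case: (x \in F B); case: (x \in X).
(* Each [x] in [X] lies in at most one [F A], so its inner sum is at most 1. *)
rewrite exchange_big /= -[leqRHS]sum1_card; apply: leq_sum => x _.
case: (pickP [pred B | (B \in C) && (x \in F B)]) => [A /andP[AC xA]|no].
  rewrite (bigD1 A) //= xA big1 // => B /andP[BC /eqP BA].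
  by case: (boolP (x \in F B)) => // xB; case: BA; apply: (Finj _ _ BC AC x).
by rewrite big1 // => B BC; move: (no B); rewrite /= BC /= => ->.
Qed.

Lemma mem_shift (n m : nat) (B : {set 'I_n * Zm m}) s p :
  (p \in shift B s) = ((p.1, p.2 - Zp1 *~ s)%R \in B).
Proof.
apply/imsetP/idP => [[[i x] xB ->]|pB] /=; first by rewrite addrK.
by exists (p.1, p.2 - Zp1 *~ s)%R => //=; rewrite subrK; case: p pB.
Qed.

(** * Differences of ordered pairs of points *)

Section Differences.
Local Open Scope ring_scope.
Variables n m : nat.
Hypothesis hm : (0 < m)%N.
Implicit Types (A B : {set 'I_n * Zm m}) (p q r : 'I_n * Zm m).

(** Shifts are indexed by integers but differences are residues; this turns a residue into a shift
    amount. *)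
Lemma Zp1_intmul (z : Zm m) : exists s : int, Zp1 *~ s = z.
Proof.
exists (z : nat)%:Z; rewrite -pmulrn Zp_mulrn; apply: val_inj => /=.
by rewrite modnMml mul1n modn_small.
Qed.

Lemma intmul_dvd (x : Zm m) (s : int) : (m%:Z %| s)%Z -> x *~ s = 0.
Proof.
case/dvdzP => k ->; rewrite mulrC mulrzA -pmulrn Zp_mulrn.
suff -> : inZp (x * m) = 0 :> Zm m by rewrite mul0rz.
by apply: val_inj => /=; move: (nat_of_ord x) => y; rewrite prednK // modnMl.
Qed.

Definition delta p q : 'I_n * 'I_n * Zm m := (p.1, q.1, q.2 - p.2).

Definition differences B :=
  [set delta w.1 w.2 | w in [set w | [&& w.1 \in B, w.2 \in B & w.1 != w.2]]].

Lemma differencesP B d :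
  reflect (exists p q, [/\ p \in B, q \in B, p != q & d = delta p q])
          (d \in differences B).
Proof.
apply: (iffP imsetP) => [[[p q]]|[p [q [pB qB pq ->]]]].
  by rewrite inE /= => /and3P[pB qB pq] ->; exists p, q.
by exists (p, q); rewrite // inE /= pB qB.
Qed.

Lemma delta_in B p q : p \in B -> q \in B -> p != q ->
  delta p q \in differences B.
Proof. by move=> pB qB pq; apply/differencesP; exists p, q. Qed.

Lemma delta_eqP p q p' q' : delta p q = delta p' q' ->
  [/\ p.1 = p'.1, q.1 = q'.1 & q.2 - p.2 = q'.2 - p'.2].
Proof.
by move=> e; split; [exact: (congr1 (fun d => d.1.1) e)
  | exact: (congr1 (fun d => d.1.2) e) | exact: (congr1 snd e)].
Qed.

Lemma delta_injl p q r : delta p q = delta p r -> q = r.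
Proof. by case: q r => [i x] [j y] /delta_eqP[_ /= -> /addIr ->]. Qed.

Lemma delta_injr p q r : delta q p = delta r p -> q = r.
Proof. by case: q r => [i x] [j y] /delta_eqP[/= -> _ /addrI /oppr_inj ->]. Qed.

(** The translate by [x] of $\{0,a,2a\}$, placed in row [i]; degenerate triples are allowed. *)
Definition arith_prog (i : 'I_n) (x a : Zm m) : {set 'I_n * Zm m} :=
  [set (i, x); (i, x + a); (i, x + a + a)].

Definition equi_in_row i B := [exists x, exists a, B == arith_prog i x a].

Lemma equi_in_rowP i B :
  reflect (exists x a, B = arith_prog i x a) (equi_in_row i B).
Proof.
apply: (iffP existsP) => [[x /existsP[a /eqP]]|[x [a BE]]]; first by exists x, a.
by exists x; apply/existsP; exists a; apply/eqP.
Qed.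

(** The row components of the equation put the three points in one row, and the common difference is
    the step. *)
Lemma delta_eq_arith_prog p q r : delta p q = delta q r ->
  [set p; q; r] = arith_prog p.1 p.2 (q.2 - p.2).
Proof.
case: p q r => [i x] [j y] [k z] /delta_eqP[/= -> -> e]; rewrite /arith_prog /=.
have -> : x + (y - x) = y by rewrite addrC subrK.
by rewrite e [y + _]addrC subrK.
Qed.

(** * Involutions, and the number of differences of a triple *)

Definition involutions : {set 'I_n * 'I_n * Zm m} :=
  [set d | [&& d.1.1 == d.1.2, d.2 != 0 & d.2 + d.2 == 0]].

(** The representative satisfies $0 < 2h < 2m$ and $m \mid 2h$. *)
Lemma involution_half (h : Zm m) : h != 0 -> h + h = 0 -> (h + h = m)%N.
Proof.
move=> h0 /(congr1 val) /= hh; have hlt := ltn_ord h.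
have : nat_of_ord h != 0%N by [].
move: hh hlt; move: (nat_of_ord h) => y; rewrite prednK // => hh hlt y0.
have /dvdnP[k kE] : (m %| y + y)%N by rewrite /dvdn hh.
by move: kE hlt y0; case: k => [|[|k]]; nia.
Qed.

(** An involution has the form $(i,i,m/2)$: one per row for even [m], none for odd [m]. The boolean
    is read as 0 or 1. *)
Lemma card_involutions : (#|involutions| <= n * ~~ odd m)%N.
Proof.
case: (boolP (odd m)) => /= mo.
  rewrite muln0 leqn0 cards_eq0; apply/eqP/setP => d; rewrite !inE.
  by apply/negP => /and3P[_ h0 /eqP /(involution_half h0) hE]; move: mo; lia.
rewrite muln1 -[leqRHS]card_ord.
apply: leq_trans (leq_imset_card (fun i : 'I_n => (i, i, inZp m./2)) _).
apply/subset_leq_card/subsetP => -[[i j] h]; rewrite inE /=.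
case/and3P => /eqP <- h0 /eqP /(involution_half h0) hE.
apply/imsetP; exists i => //; congr (_, _); apply: val_inj => /=.
by rewrite modn_small //; have := ltn_ord h; lia.
Qed.

Lemma delta_sym_involution p q : p != q -> delta p q = delta q p ->
  delta p q \in involutions.
Proof.
case: p q => [i x] [j y] pq /delta_eqP[/= ij _ e]; subst j; rewrite inE /= eqxx /=.
apply/andP; split; last by rewrite {2}e addrA subrK subrr.
by rewrite subr_eq0; apply: contra pq => /eqP ->.
Qed.

(* The three differences along a cyclic orientation of B are distinct, and so
   are their opposites; a difference common to both triples is an involution. *)
Lemma differences_of_non_equi p q r :
  [/\ p != q, q != r & r != p] ->
  (forall i, ~~ equi_in_row i [set p; q; r]) ->
  (6 <= #|differences [set p; q; r]| +
        #|differences [set p; q; r] :&: involutions|)%N.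
Proof.
move=> [pq qr rp] nequi; set B := [set p; q; r].
have neq a b c : B = [set a; b; c] -> delta a b != delta b c.
  move=> BE; apply/eqP => /delta_eq_arith_prog; rewrite -BE => e.
  by case/negP: (nequi a.1); apply/equi_in_rowP; exists a.2, (b.2 - a.2).
have rot a b c : [set a; b; c] = [set b; c; a] :> {set 'I_n * Zm m}.
  by apply/setP => d; rewrite !inE [RHS]orbC orbA.
have rev a b c : [set a; b; c] = [set c; b; a] :> {set 'I_n * Zm m}.
  by apply/setP => d; rewrite !inE orbC [(d == a) || _]orbC orbA.
have card3 (a b c : 'I_n * 'I_n * Zm m) : a != b -> b != c -> c != a ->
    #|[set a; b; c]| = 3%N.
  by move=> ab bc ca; rewrite -setUA !cardsU1 cards1 !inE negb_or ab eq_sym ca bc.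
set S1 := [set delta p q; delta q r; delta r p].
set S2 := [set delta q p; delta p r; delta r q].
have c1 : #|S1| = 3%N.
  by apply: card3; apply: neq => //; rewrite /B ?(rot p q r) // (rot q r p).
have c2 : #|S2| = 3%N.
  by apply: card3; apply: neq; rewrite /B (rev p q r) ?(rot r q p) // (rot q p r).
have [pB qB rB] : [/\ p \in B, q \in B & r \in B] by rewrite !inE !eqxx !orbT.
have s1 : S1 \subset differences B.
  by apply/subsetP => d; rewrite !inE => /orP[/orP[]|] /eqP ->; apply: delta_in.
have s2 : S2 \subset differences B.
  by apply/subsetP => d; rewrite !inE => /orP[/orP[]|] /eqP ->;
    apply: delta_in => //; rewrite eq_sym.
have s3 : S1 :&: S2 \subset involutions.
  have := delta_sym_involution; move: involutions => H symH.
  apply/subsetP => d; rewrite !inE => /andP[].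
  (* A member of [S1] and one of [S2] are either opposite or share their first or last point;
     sharing would identify two of [p], [q], [r]. *)
  by case/orP => [/orP[]|] /eqP -> /orP[/orP[]|] /eqP e;
    first [ by apply: symH
          | move: pq qr rp; rewrite (delta_injl e) eqxx
          | move: pq qr rp; rewrite (delta_injr e) eqxx ].
have := cardsUI S1 S2; rewrite c1 c2 -[6%N]/(3 + 3)%N => <-; apply: leq_add.
  by apply: subset_leq_card; rewrite subUset s1.
by apply: subset_leq_card; rewrite subsetI s3 andbT subIset // s1.
Qed.

(** The differences are $\pm a$ and $\pm 2a$. The hypotheses rule out every coincidence except $2a =
    -2a$, and then $2a$ is an involution, which the second term counts again. *)
Lemma differences_of_equi (i : 'I_n) (x a : Zm m) :
  a != 0 -> a + a != 0 -> a + a + a != 0 ->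
  (4 <= #|differences (arith_prog i x a)| +
        #|differences (arith_prog i x a) :&: involutions|)%N.
Proof.
move=> a0 a2 a3; set D := differences _; pose f (z : Zm m) := (i, i, z).
have finj : injective f by move=> y z /(congr1 snd).
have fD y z : (i, y) \in arith_prog i x a -> (i, z) \in arith_prog i x a ->
    z - y != 0 -> f (z - y) \in D.
  move=> yB zB yz; apply: (delta_in yB zB); apply: contra yz => /eqP[->].
  by rewrite subrr.
have [p0 p1 p2] : [/\ (i, x) \in arith_prog i x a, (i, x + a) \in arith_prog i x a
    & (i, x + a + a) \in arith_prog i x a] by rewrite !inE !eqxx !orbT.
have e1 : x + a - x = a by rewrite addrC addKr.
have e2 : x - (x + a) = - a by rewrite opprD addNKr.
have e3 : x + a + a - x = a + a by rewrite -(addrA x) addrAC subrr add0r.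
have e4 : x - (x + a + a) = - (a + a) by rewrite -(addrA x) opprD addNKr.
have d1 : f a \in D by have := fD _ _ p0 p1; rewrite e1; apply.
have d2 : f (- a) \in D by have := fD _ _ p1 p0; rewrite e2 oppr_eq0; apply.
have d3 : f (a + a) \in D by have := fD _ _ p0 p2; rewrite e3; apply.
have d4 : f (- (a + a)) \in D.
  by have := fD _ _ p2 p0; rewrite e4 oppr_eq0; apply.
have n12 : a != - a by rewrite -subr_eq0 opprK.
have n13 : a != a + a by rewrite -subr_eq0 opprD addNKr oppr_eq0.
have n23 : - a != a + a by rewrite -subr_eq0 -oppr_eq0 opprB opprK.
have n14 : a != - (a + a) by rewrite -subr_eq0 opprK addrA.
have n24 : - a != - (a + a) by rewrite eqr_opp.
case: (eqVneq (a + a) (- (a + a))) => [e|n34].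
  rewrite -[4%N]/(3 + 1)%N; apply: leq_add.
    have <- : #|f @: [set a; - a; a + a]| = 3%N.
      by rewrite card_imset // -setUA !cardsU1 cards1 !inE negb_or n12 n13 n23.
    apply/subset_leq_card/subsetP => _ /imsetP[z zS ->].
    by move: zS; rewrite !inE => /orP[/orP[]|] /eqP ->.
  apply/card_gt0P; exists (f (a + a)); rewrite inE d3 inE /= eqxx a2 /=.
  by rewrite {2}e subrr.
apply: leq_trans (leq_addr _ _).
have <- : #|f @: [set a; - a; a + a; - (a + a)]| = 4%N.
  rewrite card_imset // -!setUA !cardsU1 cards1 !inE !negb_or.
  by rewrite n12 n13 n14 n23 n24 n34.
apply/subset_leq_card/subsetP => _ /imsetP[z zS ->].
by move: zS; rewrite !inE => /orP[/orP[/orP[]|]|] /eqP ->.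
Qed.

(** * Difference sets of the codewords of a code *)

Variable C : {set {set 'I_n * Zm m}}.
Hypothesis oocC : is_ooc C.

(** A common difference lets one shift carry a pair of points of [B] onto a pair of points of [A],
    against [ooc_cross]. *)
Lemma ooc_differences_inj A B d : A \in C -> B \in C ->
  d \in differences A -> d \in differences B -> A = B.
Proof.
move=> AC BC /differencesP[p [q [pA qA pq ->]]].
case/differencesP => p' [q' [pB qB _ /delta_eqP[e1 e2 e3]]].
apply/eqP; apply: contraT => AB; have [s sE] := Zp1_intmul (p.2 - p'.2).
have := ooc_cross oocC s AC BC AB; rewrite leqNgt => /negP[].
have <- : #|[set p; q]| = 2%N by rewrite cards2 pq.
apply/subset_leq_card/subsetP => r; rewrite in_set2 in_setI mem_shift sE.
have e4 : q.2 - (p.2 - p'.2) = q'.2.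
  by rewrite opprB addrA addrAC e3 subrK.
case/orP => /eqP ->; rewrite ?pA ?qA /=.
  by rewrite opprB addrCA subrr addr0 e1 -surjective_pairing.
by rewrite e4 e2 -surjective_pairing.
Qed.

(** Six is the number of ordered pairs. An involution arises from a pair and its reverse, hence is
    counted twice; the last term restores the two differences lost by a progression. *)
Lemma codeword_differences B : B \in C ->
  (6 <= #|differences B| + #|differences B :&: involutions| +
        2 * \sum_(i < n) equi_in_row i B)%N.
Proof.
move=> BC; have cB := ooc_weight oocC BC.
have /card_gt2P[p [q [r [[pB qB rB] [pq qr rp]]]]] : (2 < #|B|)%N by rewrite cB.
case: (pickP (equi_in_row ^~ B)) => [i eqB|neq].
  rewrite (bigD1 i) //= eqB mulnDr -[6%N]/(4 + 2)%N addnA.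
  apply: leq_trans (leq_addr _ _); rewrite leq_add2r.
  case/equi_in_rowP: eqB => x [a BE]; rewrite BE in BC cB *.
  have a0 : a != 0.
    by apply: contra_eq_neq cB => ->; rewrite /arith_prog !addr0 !setUid cards1.
  apply: differences_of_equi => //.
    apply: contra_eq_neq cB => a2; rewrite /arith_prog -addrA a2 addr0.
    by rewrite setUAC setUid cards2; case: ((i, x) != _).
  (* If $3a = 0$, the shift by $a$ fixes the codeword, so the autocorrelation would be 3. *)
  apply/eqP => a3; have [s sE] := Zp1_intmul a.
  have ns : ~~ (m%:Z %| s)%Z.
    by apply: contra a0 => /(intmul_dvd Zp1); rewrite sE => ->.
  have := ooc_auto oocC BC ns; rewrite (setIidPl _) ?cB //.
  apply/subsetP => z; rewrite mem_shift sE !inE => /orP[/orP[]|] /eqP -> /=.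
  - apply/orP; right; apply/eqP; congr (_, _); apply: (addIr a).
    by rewrite subrK -2!(addrA x) a3 addr0.
  - by rewrite addrK eqxx.
  - by rewrite addrK eqxx orbT.
apply: leq_trans (leq_addr _ _).
have BE : B = [set p; q; r].
  apply/esym/eqP; rewrite eqEcard cB; apply/andP; split.
    by apply/subsetP => z; rewrite !inE => /orP[/orP[]|] /eqP ->.
  by rewrite -setUA !cardsU1 cards1 !inE negb_or pq [p == r]eq_sym rp qr.
rewrite BE; apply: differences_of_non_equi => // i.
by rewrite -BE neq.
Qed.

(** Disjoint difference sets lie among the $n^2m$ triples and avoid the [n] triples $(i,i,0)$, since
    the points of a pair are distinct. *)
Lemma sum_differences :
  (\sum_(B in C) #|differences B| + n <= n * n * m)%N.
Proof.
pose diag := [set (i, i, 0 : Zm m) | i : 'I_n].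
have cd : #|diag| = n by rewrite card_imset ?card_ord // => i j [].
have cT : #|{: 'I_n * 'I_n * Zm m}| = (n * n * m)%N.
  by rewrite !card_prod !card_ord prednK.
rewrite -cT -(cardsC diag) cd addnC leq_add2l.
rewrite (eq_bigr (fun B => #|differences B :&: ~: diag|)) => [|B BC].
  apply: sum_card_setI_le => A B AC BC d; exact: ooc_differences_inj.
rewrite (setIidPl _) //; apply/subsetP => _ /differencesP[p [q [pB qB pq ->]]].
rewrite inE; apply: contra pq => /imsetP[i _ e].
have [e1 e2 /eqP] : [/\ p.1 = i, q.1 = i & q.2 - p.2 = 0].
  by split; [exact: (congr1 (fun d => d.1.1) e)
    | exact: (congr1 (fun d => d.1.2) e) | exact: (congr1 snd e)].
rewrite subr_eq0 => /eqP e3.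
by rewrite [p]surjective_pairing [q]surjective_pairing e1 e2 e3.
Qed.

(** * From progressions in one row to a 1-D equi-difference code *)

Definition base_prog (a : Zm m) := Defs.row1 [set 0; a; a *+ 2].

Definition translate (i : 'I_n) (x : Zm m) (w : 'I_1 * Zm m) : 'I_n * Zm m :=
  (i, w.2 + x).

Lemma translate_inj i x : injective (translate i x).
Proof.
by case=> [j y] [k z] /(congr1 snd) /addIr /= ->; rewrite (ord1 j) (ord1 k).
Qed.

Lemma translate_base_prog i x a : translate i x @: base_prog a = arith_prog i x a.
Proof.
rewrite /base_prog /Defs.row1 -imset_comp !imsetU !imset_set1 /translate /=.
by rewrite /arith_prog add0r mulr2n ![_ + x]addrC addrA.
Qed.

(** The two starting points [x] and [y] differ in general; their difference is absorbed into the
    shift amount. *)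
Lemma translate_shift i x y (X : {set 'I_1 * Zm m}) (s t : int) :
  Zp1 *~ t = Zp1 *~ s + (x - y) :> Zm m ->
  translate i x @: shift X s = shift (translate i y @: X) t.
Proof.
move=> tE; rewrite /shift -!imset_comp; apply: eq_imset => w.
rewrite /translate /= tE; congr (_, _).
by rewrite -!addrA; congr (_ + _); rewrite [RHS]addrC -addrA subrK.
Qed.

Lemma card_base_prog_shift i x y a b (s t : int) :
  Zp1 *~ t = Zp1 *~ s + (x - y) :> Zm m ->
  #|base_prog a :&: shift (base_prog b) s| =
  #|arith_prog i x a :&: shift (arith_prog i y b) t|.
Proof.
move=> tE; rewrite -(card_imset _ (@translate_inj i x)).
rewrite imsetI => [|w z _ _]; last exact: translate_inj.
by rewrite (translate_shift i _ tE) !translate_base_prog.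
Qed.

(** Moving each progression of row [i] back to start at 0 preserves all correlations, and so yields
    an equi-difference code of the same size. *)
Lemma card_equi_in_row i : (#|[set B in C | equi_in_row i B]| <= Psi_e m)%N.
Proof.
set E := [set B in C | _].
(* [g B] picks a start and a step; the default is never reached on [E]. *)
pose g B := odflt (0, 0) [pick w | B == arith_prog i w.1 w.2].
have gP B : B \in E -> B \in C /\ B = arith_prog i (g B).1 (g B).2.
  rewrite inE => /andP[BC /equi_in_rowP[x [a BE]]]; split=> //.
  by rewrite /g; case: pickP => [w /eqP //|/(_ (x, a))]; rewrite /= BE eqxx.
pose f B := base_prog (g B).2.
have card_f B : B \in E -> #|f B| = 3%N.
  case/gP => BC BE; rewrite -(card_imset _ (@translate_inj i (g B).1)).
  by rewrite translate_base_prog -BE (ooc_weight oocC).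
have f_cross A B s : A \in E -> B \in E -> A != B ->
    (#|f A :&: shift (f B) s| <= 1)%N.
  move=> /gP[AC AE] /gP[BC BE] AB.
  have [t tE] := Zp1_intmul (Zp1 *~ s + ((g A).1 - (g B).1)).
  rewrite (card_base_prog_shift i _ _ tE) -AE -BE.
  exact: (ooc_cross oocC).
(* Distinct codewords with the same base progression would have correlation 3 at shift 0. *)
have f_inj : {in E &, injective f}.
  move=> A B AE BE fAB; apply/eqP; apply: contraT => AB.
  have := f_cross A B 0 AE BE AB; rewrite fAB (setIidPl _) ?card_f //.
  by apply/subsetP => w; rewrite mem_shift mulr0z subr0 -surjective_pairing.
rewrite -(card_in_imset f_inj); apply: leq_bigmax_cond; apply/asboolP; split.
  split.
  - by move=> _ /imsetP[B BE ->]; apply: card_f.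
  - move=> _ s /imsetP[B /gP[BC BE] ->] ns.
    (* Both copies have the same start, so the shift amount is unchanged. *)
    rewrite (@card_base_prog_shift i (g B).1 (g B).1 _ _ s s) ?subrr ?addr0 //.
    by rewrite -BE; apply: (ooc_auto oocC).
  - move=> _ _ s /imsetP[A AE ->] /imsetP[B BE ->] fAB.
    by apply: f_cross => //; apply: contra fAB => /eqP ->.
by move=> _ /imsetP[B _ ->]; exists (g B).2.
Qed.

(** * Summation over the code *)

Lemma ooc_card_bound :
  (6 * #|C| + n <= n * n * m + n * ~~ odd m + 2 * (n * Psi_e m))%N.
Proof.
have inv : (\sum_(B in C) #|differences B :&: involutions| <= n * ~~ odd m)%N.
  apply: leq_trans card_involutions.
  by apply: sum_card_setI_le => A B AC BC d; apply: ooc_differences_inj.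
(* Exchanging the sums counts the progressions row by row, at most [Psi_e m] in each. *)
have equi : (\sum_(B in C) \sum_(i < n) equi_in_row i B <= n * Psi_e m)%N.
  rewrite exchange_big /= -[X in (X * _)%N]card_ord -sum_nat_const.
  apply: leq_sum => i _.
  apply: leq_trans (card_equi_in_row i); rewrite -sum1_card.
  rewrite [leqRHS]big_mkcond [leqLHS]big_mkcond /=; apply: leq_sum => B _.
  by rewrite inE; case: (B \in C); case: equi_in_row.
have : (6 * #|C| <= \sum_(B in C) (#|differences B| +
    #|differences B :&: involutions| + 2 * \sum_(i < n) equi_in_row i B))%N.
  by rewrite mulnC -sum_nat_const; apply: leq_sum => B /codeword_differences.
rewrite 2!big_split /= -big_distrr /= => le6.
apply: leq_trans (leq_add (leq_add sum_differences inv)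
  (leq_mul (leqnn 2) equi)).
by rewrite [X in (_ <= X + _)%N]addnAC [leqRHS]addnAC leq_add2r.
Qed.

End Differences.

Theorem lemma3p2 (n m : nat) (hn : 0 < n) (hm : 0 < m) :
  Phi n m <=
    if odd m then (n * (n * m + 2 * Psi_e m - 1)) %/ 6
    else (n * (n * m + 2 * Psi_e m)) %/ 6.
Proof.
apply/bigmax_leqP => C /asboolP oocC; have := ooc_card_bound hm oocC.
(* For even [m] the [n] involutions cancel the [n] on the left; for odd [m] that [n] remains and
   gives the $-1$. The truncated subtraction is exact because $nm \ge 1$. *)
by case: (odd m); rewrite /= leq_divRL //; nia.
Qed.
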